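(* Up to isomorphism, the only asymmetrical $4$-quasi-transitive critical kernel imperfect digraphs are $\overrightarrow{A}_3$ and $\overrightarrow{C}_5$. That is, an asymmetrical $4$-quasi-transitive digraph $D$ is critical kernel imperfect if and only if $D\cong\overrightarrow{A}_3$ or $D\cong\overrightarrow{C}_5$.
   Context: All digraphs are finite, with no loops and no multiple arcs (a pair of opposite arcs $(u,v),(v,u)$ is allowed). A digraph is asymmetrical if for every arc $(u,v)$, $(v,u)$ is not an arc. A kernel of $D$ is a set $K\subseteq V(D)$ that is independent (no arcs between its vertices) and absorbent (for every $u\in V(D)\setminus K$ there is $v\in K$ with $(u,v)\in A(D)$). $D$ is critical kernel imperfect if $D$ has no kernel but every proper induced subdigraph of $D$ has a kernel. A $k$-path is a directed path (distinct vertices) of length $k$. $D$ is $4$-quasi-transitive if for all vertices $u,v$, the existence of a $4$-path from $u$ to $v$ implies that $(u,v)\in A(D)$ or $(v,u)\in A(D)$. $\overrightarrow{C}_n$ is the directed cycle on $\mathbb{Z}_n$ with arcs $(i,i+1)$; $\overrightarrow{A}_n$ ($n\ge 3$) is the digraph on $\mathbb{Z}_n$ with arcs $(i,j)$ for $j-i\in\{1,\dots,n-2\}$ (so $\overrightarrow{A}_3=\overrightarrow{C}_3$). *)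

(* Defs.v *)
From mathcomp Require Import all_boot all_algebra.

Set Implicit Arguments.
Unset Strict Implicit.
Unset Printing Implicit Defensive.

Record digraph := Digraph {
  vertex :> finType;
  arc : rel vertex;
  arc_irr : irreflexive arc
}.

Definition asymmetrical (D : digraph) : Prop :=
  forall u v : D, arc u v -> ~~ arc v u.

Definition independent (D : digraph) (K : {set D}) : Prop :=
  forall u v : D, u \in K -> v \in K -> ~~ arc u v.

Definition absorbent (D : digraph) (K : {set D}) : Prop :=
  forall u : D, u \notin K -> exists v : D, v \in K /\ arc u v.

Definition kernel (D : digraph) (K : {set D}) : Prop :=
  independent K /\ absorbent K.

Definition has_kernel (D : digraph) : Prop := exists K : {set D}, kernel K.

Definition induced_arc (D : digraph) (S : {set D}) : rel {x : D | x \in S} :=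
  fun u v => arc (val u) (val v).

Lemma induced_arc_irr (D : digraph) (S : {set D}) :
  irreflexive (@induced_arc D S).
Proof. by move=> u; apply: arc_irr. Qed.

Definition induced (D : digraph) (S : {set D}) : digraph :=
  Digraph (@induced_arc_irr D S).

(* S = set0 is harmless: the digraph without vertices has the empty kernel. *)
Definition critical_kernel_imperfect (D : digraph) : Prop :=
  ~ has_kernel D /\
  forall S : {set D}, S \proper [set: D] -> has_kernel (induced S).

(* The vertices of the path are u :: p, so its length is size p. *)
Definition is_kpath (D : digraph) (k : nat) (u v : D) (p : seq D) : Prop :=
  [/\ path (@arc D) u p, uniq (u :: p), size p = k & last u p = v].

Definition quasi_transitive (k : nat) (D : digraph) : Prop :=
  forall u v : D, (exists p : seq D, is_kpath k u v p) -> arc u v \/ arc v u.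

Definition isomorphic (D1 D2 : digraph) : Prop :=
  exists f : D1 -> D2,
    bijective f /\ forall u v : D1, arc (f u) (f v) = arc u v.

(* 'Z_n is the ring of integers mod n only for n >= 2, so dicycle n and
   antihole n are meant for n >= 2 and n >= 3 respectively. *)
Definition dicycle_arc (n : nat) : rel 'Z_n := fun i j => (j == i + 1)%R.

Lemma dicycle_arc_irr (n : nat) : irreflexive (@dicycle_arc n).
Proof.
by move=> i; rewrite /dicycle_arc -[X in X == _]GRing.addr0
  (inj_eq (GRing.addrI i)) eq_sym GRing.oner_eq0.
Qed.

Definition dicycle (n : nat) : digraph := Digraph (@dicycle_arc_irr n).

(* The difference j - i is taken in 'Z_n, then read as its representative in
   {0, ..., n - 1}. *)
Definition antihole_arc (n : nat) : rel 'Z_n :=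
  fun i j => 0 < (j - i)%R <= n - 2.

Lemma antihole_arc_irr (n : nat) : irreflexive (@antihole_arc n).
Proof. by move=> i; rewrite /antihole_arc GRing.subrr. Qed.

Definition antihole (n : nat) : digraph := Digraph (@antihole_arc_irr n).

(* Main.v *)
(* A critical kernel imperfect digraph D has no proper nonempty out-closed set:
   a kernel of such a set would be a semikernel, extendable to a kernel of D.
   Hence D is strongly connected.  A directed triangle of D is induced, by
   asymmetry, and has no kernel, so it is all of D.

   Otherwise D is triangle-free and walks of length 4 have equal or adjacent
   ends.  D contains a closed walk x of length 5: if not, the ball of radius 3
   around a vertex is out-closed, which gives a 4-cycle C; either D = C has a
   kernel, or some y outside C satisfies x_i -> y -> x_{i+1} and turns C into a
   pentagon.  (A vertex dominated by all of C would never lead back to C.)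

   Every vertex y outside a pentagon x is a twin of some x_{j+1}, that is
   x_j -> y -> x_{j+2}, and is then not adjacent to x_{j+1}.  If x had a chord
   x_0 -> x_2, this would make {x_2, x_4} a kernel of D.  So x is an induced
   pentagon; having no kernel, it is all of D. *)

From mathcomp Require Import all_boot.
From mathcomp Require Import all_algebra zify.
Require Import Defs.

Set Implicit Arguments.
Unset Strict Implicit.
Unset Printing Implicit Defensive.

Import GRing.Theory.

(** * Kernels, closed sets and strong connectivity *)

Definition kernel_in (D : digraph) (S K : {set D}) : Prop :=
  [/\ K \subset S, independent K &
      forall u : D, u \in S -> u \notin K -> exists v : D, v \in K /\ arc u v].

Lemma has_kernel_induced (D : digraph) (S : {set D}) :
  has_kernel (induced S) <-> exists K, kernel_in S K.
Proof.
split=> [[K [indK absK]]|[K [/subsetP KS indK absK]]].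
- exists [set val u | u in K]; split.
  + by apply/subsetP=> _ /imsetP[u _ ->]; exact: valP.
  + by move=> _ _ /imsetP[u uK ->] /imsetP[v vK ->]; exact: (indK u v).
  + move=> u uS uK.
    have /absK[v [vK uv]] : (Sub u uS : induced S) \notin K.
      by apply: contraNN uK => uK; apply/imsetP; exists (Sub u uS).
    by exists (val v); split=> //; apply: imset_f.
- exists [set u : induced S | val u \in K]; split.
  + by move=> u v; rewrite !inE; apply: indK.
  + move=> u; rewrite inE => uK.
    have [v [vK uv]] := absK _ (valP u) uK.
    by exists (Sub v (KS v vK) : induced S); rewrite inE.
Qed.

Lemma cki_kernel_in (D : digraph) (S : {set D}) :
  critical_kernel_imperfect D -> S \proper [set: D] ->
  exists K, kernel_in S K.
Proof. by move=> [_ kS] /kS /has_kernel_induced. Qed.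

(** All arcs point forward in the list, so a kernel grows from the end: a new head joins it unless
    it already has an out-neighbour in it. *)
Lemma acyclic_kernel (D : digraph) (s : seq D) :
  pairwise (fun u v => ~~ arc v u) s -> exists K, kernel_in [set x in s] K.
Proof.
elim: s => [_|x s IHs] /=.
  exists set0; split; first exact: sub0set.
    by move=> u v; rewrite inE.
  by move=> u; rewrite !inE.
move=> /andP[/allP xs /IHs[K [/subsetP KS indK absK]]].
have KxS : K \subset [set y in x :: s].
  by apply/subsetP=> y /KS; rewrite !inE => ->; rewrite orbT.
have [/existsP[y /andP[yK xy]]|/existsPn xK] :=
  boolP [exists y, (y \in K) && arc x y].
  exists K; split=> // u; rewrite !inE => /orP[/eqP-> _|us uK].
    by exists y.
  by apply: absK; rewrite ?inE.
exists (x |: K); split.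
- by rewrite subUset KxS andbT sub1set !inE eqxx.
- move=> u v /setU1P[->|uK] /setU1P[->|vK].
  + by rewrite arc_irr.
  + by have := xK v; rewrite vK.
  + by apply: xs; have := KS u uK; rewrite inE.
  + exact: indK.
- move=> u; rewrite !inE negb_or => uxs /andP[ux uK].
  have us : u \in [set y in s] by move: uxs; rewrite (negPf ux) inE.
  by have [v [vK uv]] := absK u us uK; exists v; rewrite !inE vK orbT.
Qed.

Lemma cki_closed (D : digraph) (S : {set D}) (x : D) :
  critical_kernel_imperfect D -> x \in S ->
  (forall u v, u \in S -> arc u v -> v \in S) -> S = [set: D].
Proof.
move=> cki xS closedS; apply/eqP; apply/negPn/negP=> SnT.
have [|K [/subsetP KS indK absK]] := cki_kernel_in (S := S) cki.
  by rewrite properT.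
have [k kK] : exists k, k \in K.
  have [xK|xK] := boolP (x \in K); first by exists x.
  by have [k [kK _]] := absK x xS xK; exists k.
(* K is a semikernel of D: it absorbs everything it reaches. *)
pose T := [set v | (v \notin K) && [forall w in K, ~~ arc v w]].
have [|L [/subsetP LT indL absL]] := cki_kernel_in (S := T) cki.
  by rewrite properT; apply/eqP=> /setP/(_ k); rewrite !inE kK.
have LK u v : u \in L -> v \in K -> ~~ arc u v.
  by move=> /LT; rewrite inE => /andP[_ /forallP/(_ v)/implyP].
case: cki => nk _; apply: nk; exists (K :|: L); split.
- move=> u v /setUP[uK|uL] /setUP[vK|vL]; [exact: indK| |exact: LK|exact: indL].
  (* As [S] is closed, [v] lies in [S], hence is in [K] or absorbed by [K]; [T] excludes both. *)
  apply/negP=> uv; have := LT v vL; rewrite inE => /andP[vK _].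
  have [w [wK vw]] := absK v (closedS _ _ (KS _ uK) uv) vK.
  by have := LK v w vL wK; rewrite vw.
- move=> u; rewrite !inE negb_or => /andP[uK uL].
  have [uT|] := boolP (u \in T).
    by have [v [vL uv]] := absL u uT uL; exists v; rewrite inE vL orbT.
  rewrite inE uK /= => /forallPn[v]; rewrite negb_imply negbK => /andP[vK uv].
  by exists v; rewrite inE vK.
Qed.

Lemma cki_connect (D : digraph) (u v : D) :
  critical_kernel_imperfect D -> connect (@arc D) u v.
Proof.
move=> cki; have /setP/(_ v) : [set w | connect (@arc D) u w] = [set: D].
  apply: (cki_closed (x := u) cki); rewrite ?inE // => a b.
  rewrite !inE => ua ab.
  exact: connect_trans ua (connect1 ab).
by rewrite !inE.
Qed.

Lemma connect_ind (T : finType) (e : rel T) (P : T -> Prop) (u v : T) :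
  (forall x y, P x -> e x y -> P y) -> connect e u v -> P u -> P v.
Proof.
move=> stepP /connectP[p]; elim: p u => [u _ -> //|x p IHp u] /=.
by move=> /andP[ux xp] vE Pu; apply: (IHp x) => //; apply: stepP ux.
Qed.

(** * Odd directed cycles *)

(** Going round once makes an odd number of flips and returns to 0. Membership in a kernel of a
    directed cycle alternates in this way. *)
Lemma odd_alternating (n : nat) (P : pred 'Z_n) :
  1 < n -> odd n -> (forall i, P (i + 1)%R = ~~ P i) -> False.
Proof.
move=> n1 oddn altP.
have Pk (k : nat) : P k%:R%R = odd k (+) P 0%R.
  by elim: k => //= k IHk; rewrite -addn1 natrD altP IHk addNb.
by have := Pk n; rewrite pchar_Zp // oddn; case: (P 0%R).
Qed.

Lemma kernel_in_dicycle (D : digraph) (n : nat) (g : 'Z_n -> D) (K : {set D}) :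
  1 < n -> odd n ->
  (forall i j, arc (g i) (g j) = dicycle_arc i j) ->
  kernel_in [set g i | i : 'Z_n] K -> False.
Proof.
move=> n1 oddn garc [/subsetP KS indK absK].
apply: (@odd_alternating n (fun i => g i \in K)) => // i.
have [gi|gi] /= := boolP (g i \in K).
  by apply/negP=> gj; have := indK _ _ gi gj; rewrite garc /dicycle_arc eqxx.
have [|v [vK]] := absK (g i) _ gi; first exact: imset_f.
by have /imsetP[j _ vE] := KS v vK; rewrite vE garc => /eqP<-; rewrite -vE.
Qed.

Lemma dicycle_cki (D : digraph) (n : nat) (f : D -> dicycle n) :
  1 < n -> odd n -> bijective f ->
  (forall u v, arc (f u) (f v) = arc u v) -> critical_kernel_imperfect D.
Proof.
move=> n1 oddn [g fK gK] farc.
have garc i j : arc (g i) (g j) = dicycle_arc i j by rewrite -farc !gK.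
split=> [[K [indK absK]]|S].
  apply: (kernel_in_dicycle n1 oddn garc (K := K)); split=> //.
    by apply/subsetP=> u _; apply/imsetP; exists (f u); rewrite ?fK.
  by move=> u _; apply: absK.
rewrite properT -subTset => /subsetPn[u _ uS].
(* The cycle is cut open at the missing vertex [u], so that all remaining arcs point forward in the
   list. *)
pose s := [seq x <- [seq g (f u + k%:R)%R | k <- iota 1 n.-1] | x \in S].
have [|K] := @acyclic_kernel D s.
  apply: subseq_pairwise (filter_subseq _ _) _.
  rewrite pairwise_map.
  apply: (@sub_in_pairwise _ (mem (iota 1 n.-1)) ltn).
  - move=> k l; rewrite !mem_iota => kn ln kl.
    rewrite /= garc /dicycle_arc -addrA (inj_eq (addrI _)) -(natrD _ l 1).
    apply/negP=> /eqP/(congr1 (@nat_of_ord _)); rewrite !val_Zp_nat //.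
    have [ln'|ln'] := ltnP (l + 1) n; first by rewrite !modn_small; lia.
    have -> : l + 1 = n by lia.
    by rewrite modnn modn_small; lia.
  - by apply/allP.
  - by rewrite -sorted_pairwise ?iota_ltn_sorted //; exact: ltn_trans.
have -> : [set x in s] = S.
  apply/setP=> v; rewrite inE mem_filter; case: (boolP (v \in S)) => //= vS.
  apply/mapP; exists (nat_of_ord (f v - f u)%R); last first.
    by rewrite natr_Zp addrC subrK fK.
  have vu : (f v - f u)%R != 0%R :> 'Z_n.
    rewrite subr_eq0; apply: contraNneq uS => /(congr1 g).
    by rewrite !fK => <-.
  rewrite mem_iota lt0n; move: vu (ltn_ord (f v - f u)%R).
  rewrite -val_eqE /=; set w := nat_of_ord _; rewrite [X in _ < X](Zp_cast n1).
  lia.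
by move=> kK; apply/has_kernel_induced; exists K.
Qed.

Lemma cki_dicycle (D : digraph) (n : nat) (g : 'Z_n -> D) :
  1 < n -> odd n -> critical_kernel_imperfect D ->
  (forall i j, arc (g i) (g j) = dicycle_arc i j) -> isomorphic D (dicycle n).
Proof.
move=> n1 oddn cki garc.
have ginj : injective g.
  (* Equal images have the same out-neighbours, and these determine the index. *)
  move=> i j gij; have := garc i (i + 1)%R; rewrite gij garc /dicycle_arc eqxx.
  by move=> /eqP/addIr.
have gT : [set g i | i : 'Z_n] = [set: D].
  apply/eqP; apply/negPn; rewrite -properT; apply/negP=> gT.
  have [K kK] := cki_kernel_in cki gT.
  exact: (kernel_in_dicycle n1 oddn garc kK).
have gP x : exists i, g i == x.
  have : x \in [set g i | i : 'Z_n] by rewrite gT inE.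
  by case/imsetP=> i _ ->; exists i.
pose f x : dicycle n := xchoose (gP x).
have fK : cancel f g by move=> x; apply/eqP/(xchooseP (gP x)).
exists f; split; last by move=> u v; rewrite -{2}(fK u) -{2}(fK v) garc.
by exists g => // i; apply: ginj; rewrite fK.
Qed.

Lemma antihole3_arc (i j : 'Z_3) : antihole_arc i j = dicycle_arc i j.
Proof. by case: i => [[|[|[]]] //] ?; case: j => [[|[|[]]] //] ?. Qed.

Lemma isomorphic_antihole3 (D : digraph) :
  isomorphic D (antihole 3) <-> isomorphic D (dicycle 3).
Proof.
by split=> -[f [bf farc]]; exists f; split=> // u v;
  rewrite -farc /= antihole3_arc.
Qed.

(** * Closed walks *)

(* A closed walk of length n, unrolled periodically so that rotating it is
   shifting the index. *)
Definition closed_walk (D : digraph) (n : nat) (x : nat -> D) : Prop :=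
  (forall i, arc (x i) (x i.+1)) /\ (forall i, x (i + n) = x i).

Lemma closed_walk_shift (D : digraph) (n k : nat) (x : nat -> D) :
  closed_walk n x -> closed_walk n (fun i => x (i + k)).
Proof. by case=> xx xn; split=> i; [exact: xx | rewrite addnAC]. Qed.

Lemma closed_walk_modn (D : digraph) (n i k : nat) (x : nat -> D) :
  closed_walk n x -> x (i %% n + k) = x (i + k).
Proof.
case=> _ xn; rewrite [in RHS](divn_eq i n) -addnA.
by elim: (i %/ n) => // q ->; rewrite mulSn -addnA [in RHS]addnC xn.
Qed.

Lemma closed_walk_nth (D : digraph) (x0 : D) (p : seq D) :
  cycle (@arc D) (x0 :: p) ->
  closed_walk (size p).+1 (fun i => nth x0 (x0 :: p) (i %% (size p).+1)).
Proof.
move=> /(pathP x0); rewrite size_rcons => cp.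
split=> i; last by rewrite modnDr.
have ip : i %% (size p).+1 < (size p).+1 by rewrite ltn_pmod.
rewrite -[X in arc _ (nth _ _ (X %% _))]addn1 -modnDml addn1.
have := cp _ ip; move: ip; rewrite -rcons_cons nth_rcons.
set j := i %% _ => jp; rewrite /= jp nth_rcons; move: jp.
rewrite ltnS leq_eqVlt => /orP[/eqP->|jp].
  by rewrite ltnn eqxx modnn.
by rewrite jp modn_small.
Qed.

(** [Q] is a goal that any step may settle; otherwise [P] travels once round the walk, and
    periodicity also covers the indices below [i]. *)
Lemma closed_walk_ind (D : digraph) (n i : nat) (x : nat -> D)
    (P : D -> Prop) (Q : Prop) :
  0 < n -> closed_walk n x -> (forall j, P (x j) -> Q \/ P (x j.+1)) ->
  P (x i) -> Q \/ forall j, P (x j).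
Proof.
move=> n0 cw stepP Pi.
have Pk k : Q \/ forall j, j < k -> P (x (i + j)).
  elim: k => [|[|k] [q|IHk]]; [by right|by left| |by left|].
    by right=> [[]] // _; rewrite addn0.
  have [|q|Pk] := stepP (i + k); [exact: IHk|by left|right=> j].
  rewrite ltnS leq_eqVlt => /orP[/eqP->|/IHk //]; by rewrite addnS.
have [q|Pn] := Pk n; [by left|right=> j].
(* Adding [i * n.-1] amounts to subtracting [i] modulo [n]. *)
have -> : x j = x (i + (j + i * n.-1) %% n).
  rewrite addnC (closed_walk_modn _ _ cw) -addnA -mulnSr prednK //.
  rewrite [j + _]addnC -[_ + j]addn0 -(closed_walk_modn _ _ cw) modnMDl.
  by rewrite (closed_walk_modn _ _ cw) addn0.
by apply: Pn; rewrite ltn_pmod.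
Qed.

Lemma val_ZpD (n : nat) (i j : 'Z_n) :
  1 < n -> nat_of_ord (i + j)%R = (i + j) %% n.
Proof. by case: n i j => [|[|n]]. Qed.

Lemma cki_closed_walk (D : digraph) (n : nat) (x : nat -> D) :
  1 < n -> odd n -> critical_kernel_imperfect D -> closed_walk n x ->
  (forall i m, m < n -> arc (x i) (x (i + m)) = (m == 1)) ->
  isomorphic D (dicycle n).
Proof.
move=> n1 oddn cki cw xarc.
apply: (@cki_dicycle _ _ (fun i => x i)) => // i j.
have -> : x j = x (i + (j - i)%R).
  have jE : nat_of_ord j = (i + (j - i)%R) %% n
    by rewrite -val_ZpD // addrC subrK.
  by rewrite jE -[_ %% n]addn0 (closed_walk_modn _ _ cw) addn0.
rewrite xarc; last first.
  by have := ltn_ord (j - i)%R; rewrite [X in _ < X](Zp_cast n1).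
by rewrite /dicycle_arc [(i + 1)%R]addrC -subr_eq -val_eqE.
Qed.

(** * Strongly connected digraphs without directed triangles *)

Definition triangle_free (D : digraph) : Prop :=
  forall x y z : D, arc x y -> arc y z -> ~~ arc z x.

Definition tame (D : digraph) : Prop :=
  [/\ asymmetrical D, triangle_free D, quasi_transitive 4 D
    & forall u v : D, connect (@arc D) u v].

(* Without 2-cycles and triangles, a walk of length 4 with distinct ends is a
   path. *)
Lemma tame_walk4 (D : digraph) (u a b c v : D) :
  tame D -> arc u a -> arc a b -> arc b c -> arc c v -> u != v ->
  arc u v \/ arc v u.
Proof.
move=> [asym tri qt _] ua ab bc cv uv; apply: qt; exists [:: a; b; c; v].
split=> //=; first by rewrite ua ab bc cv.
have neq (w z : D) : arc w z -> w != z.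
  by move=> wz; apply: contraTneq wz => ->; rewrite arc_irr.
have neq2 (w t z : D) : arc w t -> arc t z -> w != z.
  by move=> /asym wt tz; apply: contraNneq wt => ->.
have neq3 (w t s z : D) : arc w t -> arc t s -> arc s z -> w != z.
  by move=> wt ts sz; apply: contraTneq sz => <-; exact: tri ts.
rewrite !inE !negb_or uv (neq u a) // (neq a b) // (neq b c) // (neq c v) //.
rewrite (neq2 u a b) // (neq2 a b c) // (neq2 b c v) //.
by rewrite (neq3 u a b c) // (neq3 a b c v).
Qed.

(** Being dominated by the whole walk passes from [w] to any out-neighbour [z], through x_i ->
    x_{i+1} -> x_{i+2} -> w -> z. It would thus reach [x 0], giving a loop. *)
Lemma tame_no_dominated (D : digraph) (x : nat -> D) (y : D) :
  tame D -> (forall i, arc (x i) (x i.+1)) -> ~ forall i, arc (x i) y.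
Proof.
move=> tD xx xy; have [asym tri _ conn] := tD.
suff /(_ 0) : forall i, arc (x i) (x 0) by rewrite arc_irr.
apply: (connect_ind (P := fun z => forall i, arc (x i) z) _ (conn y (x 0)) xy).
move=> w z xw wz i.
have [|//|zx] := tame_walk4 tD (xx i) (xx i.+1) (xw _) wz.
  by apply: contraTneq wz => <-; apply: asym.
by have := tri _ _ _ (xw i) wz; rewrite zx.
Qed.

Lemma tame_no_dominating (D : digraph) (n : nat) (x : nat -> D) (y : D) :
  tame D -> 1 < n -> closed_walk n x -> ~ forall i, arc y (x i).
Proof.
move=> tD n1 [xx xn] yx; have [asym tri _ conn] := tD.
(* Dominating the walk passes backwards along arcs, so its negation is propagated forwards. *)
pose P z := ~ forall i, arc z (x i).
suff: P y by [].
apply: (connect_ind (P := P) _ (conn (x 0) y)); last first.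
  by move/(_ 0); rewrite arc_irr.
move=> z w nz zw yw; apply: nz => j.
rewrite -xn -(subnK n1) addnA addn2.
have [|//|xz] := tame_walk4 tD zw (yw (j + (n - 2))) (xx _) (xx _).
  by apply: contraTneq zw => ->; apply: asym.
by have := tri _ _ _ zw (yw (j + (n - 2)).+2); rewrite xz.
Qed.

(** In a closed walk of length 6 the fifth vertex must dominate the first, the opposite arc closing
    a triangle with the sixth. Three rotations give the triangle a -> c -> e -> a. *)
Lemma tame_no_hexagon (D : digraph) (a b c d e f : D) :
  tame D -> arc a b -> arc b c -> arc c d -> arc d e -> arc e f -> ~~ arc f a.
Proof.
move=> tD; have [asym tri _ _] := tD.
have step (u1 u2 u3 u4 u5 u6 : D) : arc u1 u2 -> arc u2 u3 -> arc u3 u4 ->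
    arc u4 u5 -> arc u5 u6 -> arc u6 u1 -> arc u5 u1.
  move=> a12 a23 a34 a45 a56 a61.
  have [|a15|//] := tame_walk4 tD a12 a23 a34 a45.
    by apply: contraTneq a61 => ->; apply: asym.
  by have := tri _ _ _ a56 a61; rewrite a15.
move=> ab bc cd de ef; apply/negP=> fa.
have ea := step _ _ _ _ _ _ ab bc cd de ef fa.
have ac := step _ _ _ _ _ _ cd de ef fa ab bc.
have ce := step _ _ _ _ _ _ ef fa ab bc cd de.
by have := tri _ _ _ ac ce; rewrite ea.
Qed.

(** * Twins and chords of a pentagon *)

Lemma tame_twin_out (D : digraph) (x : nat -> D) (y : D) (i : nat) :
  tame D -> closed_walk 5 x -> (forall j, y != x j) -> arc (x i) y ->
  exists j, arc (x j) y /\ arc y (x j.+2).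
Proof.
move=> tD cw yx xy; have [xx x5] := cw.
set Q := exists j, _; suff [//|xy'] : Q \/ forall j, arc (x j) y.
  by case: (tame_no_dominated tD xx xy').
(* The 4-walk x_{j+2}, x_{j+3}, x_{j+4}, x_j, y makes [y] adjacent to x_{j+2}. *)
have step j : arc (x j) y -> Q \/ arc (x j.+2) y.
  move=> jy; have := tame_walk4 tD (xx j.+2) (xx j.+3) (xx j.+4).
  rewrite -[j.+4.+1]/(5 + j) addnC x5 => /(_ y jy).
  by rewrite eq_sym => /(_ (yx _)) [?|?]; [right|left; exists j].
apply: (closed_walk_ind (P := fun z => arc z y) _ cw _ xy) => // j.
(* Three jumps by 2 advance the index by 1 modulo 5. *)
move=> /step[?|/step[?|/step[?|]]]; try by left.
by rewrite -[x j.+1]x5 addnC; right.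
Qed.

Lemma tame_twin_in (D : digraph) (x : nat -> D) (y : D) (i : nat) :
  tame D -> closed_walk 5 x -> (forall j, y != x j) -> arc y (x i) ->
  exists j, arc (x j) y /\ arc y (x j.+2).
Proof.
move=> tD cw yx xy; have [xx x5] := cw.
set Q := exists j, _; suff [//|xy'] : Q \/ forall j, arc y (x j).
  by case: (tame_no_dominating tD _ cw xy').
have step j : arc y (x j) -> Q \/ arc y (x j.+3).
  move=> jy; have := tame_walk4 tD jy (xx j) (xx j.+1) (xx j.+2) (yx _).
  by case=> ?; [right|left; exists j.+3; rewrite -[j.+3.+2]/(5 + j) addnC x5].
apply: (closed_walk_ind (P := fun z => arc y z) _ cw _ xy) => // j.
(* Two jumps by 3 advance the index by 1 modulo 5. *)
move=> /step[?|/step[?|]]; try by left.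
by rewrite -[x j.+1]x5 addnC; right.
Qed.

Lemma closed_walk_mem (D : digraph) (n : nat) (x : nat -> D) (y : D) :
  0 < n -> closed_walk n x -> (exists i, y = x i) \/ (forall i, y != x i).
Proof.
move=> n0 cw.
have [/mapP[i _ ->]|yx] := boolP (y \in [seq x i | i <- iota 0 n]).
  by left; exists i.
right=> i; apply: contraNneq yx => ->; apply/mapP; exists (i %% n).
  by rewrite mem_iota ltn_pmod.
by rewrite -[i in LHS]addn0 -[i %% n]addn0 (closed_walk_modn _ _ cw).
Qed.

Lemma tame_twin (D : digraph) (x : nat -> D) (y : D) :
  tame D -> closed_walk 5 x ->
  (exists i, y = x i) \/
  (forall i, y != x i) /\ exists j, arc (x j) y /\ arc y (x j.+2).
Proof.
move=> tD cw; have [asym tri qt conn] := tD; have [xx x5] := cw.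
pose P y := (exists i, y = x i) \/
  (forall i, y != x i) /\ exists j, arc (x j) y /\ arc y (x j.+2).
suff: P y by [].
apply: (connect_ind (P := P) _ (conn (x 0) y)); last by left; exists 0.
move=> {}y z Py yz.
have [zx|zx] := closed_walk_mem z (isT : 0 < 5) cw; first by left.
right; split=> //; case: Py => [[i yE]|[yx [j [jy yj]]]].
  by apply: (tame_twin_out (i := i)); rewrite -?yE.
(* The walk x_{j+3}, x_{j+4}, x_j, y, z makes [z] adjacent to the pentagon. *)
have [||xz|zx'] := tame_walk4 tD (xx j.+3) (xx j.+4) _ yz.
- by rewrite -[j.+4.+1]/(5 + j) addnC x5.
- by rewrite eq_sym zx.
- exact: tame_twin_out xz.
- exact: tame_twin_in zx'.
Qed.

(** An arc in either direction would let [y] be inserted next to x_{j+1}, turning the pentagon into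
    a closed walk of length 6. *)
Lemma tame_twin_nonadjacent (D : digraph) (x : nat -> D) (y : D) (j : nat) :
  tame D -> closed_walk 5 x -> arc (x j) y -> arc y (x j.+2) ->
  ~~ arc (x j.+1) y && ~~ arc y (x j.+1).
Proof.
move=> tD [xx x5] jy yj; have xj : arc (x j.+4) (x j).
  by rewrite -[x j]x5 addnC.
apply/andP; split; apply/negP=> a.
  have := tame_no_hexagon tD (xx j) a yj (xx j.+2) (xx j.+3).
  by rewrite xj.
have := tame_no_hexagon tD jy a (xx j.+1) (xx j.+2) (xx j.+3).
by rewrite xj.
Qed.

Lemma tame_chord_kernel (D : digraph) (x : nat -> D) (i : nat) :
  tame D -> closed_walk 5 x -> arc (x i) (x i.+2) -> has_kernel D.
Proof.
move=> tD /(closed_walk_shift i) cw; move: cw; rewrite -[i in x i]add0n.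
set w := fun j => x (j + i); rewrite -[x i.+2]/(w 2) -[x (0 + i)]/(w 0).
move: w => {x} x cw c02; have [asym tri qt conn] := tD; have [xx x5] := cw.
have x40 : arc (x 4) (x 0) by have := xx 4; rewrite (x5 0).
have x42 : ~~ arc (x 4) (x 2) by exact: tri (xx 2) (xx 3).
have x24 : ~~ arc (x 2) (x 4) by exact: tri x40 c02.
exists [set x 2; x 4]; split.
  by move=> u v /set2P[]-> /set2P[]->; rewrite ?arc_irr.
move=> y; rewrite !inE negb_or => /andP[y2 y4].
suff: arc y (x 2) || arc y (x 4).
  by case/orP=> ?; [exists (x 2)|exists (x 4)]; rewrite !inE eqxx ?orbT.
have [[j yE]|[yx [j []]]] := tame_twin y tD cw.
  move: y2 y4; rewrite {y}yE -[j]addn0 -(closed_walk_modn _ _ cw) addn0.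
  have := ltn_pmod j (isT : 0 < 5); move: (j %% 5) => {}j.
  by case: j => [|[|[|[|[|]]]]] //; rewrite ?eqxx ?c02 ?xx ?orbT.
have jE k : x (j + k) = x (j %% 5 + k) by rewrite (closed_walk_modn _ _ cw).
move: (jE 0) (jE 2); rewrite !addn0 !addn2 => -> ->.
have := ltn_pmod j (isT : 0 < 5); move: (j %% 5) => {jE}j j5 jy yj.
have /andP[njy nyj] := tame_twin_nonadjacent tD cw jy yj.
(* For [j] = 0 or 2, [y] dominates x_2 or x_4. In the other cases a 4-walk through the chord joins
   [y] and its twin x_{j+1}, which are not adjacent. *)
case: j j5 jy yj njy nyj => [|[|[|[|[|]]]]] // _ jy yj njy nyj.
- by rewrite yj.
- have [ya|ya] := tame_walk4 tD yj (xx 3) x40 c02 (yx _).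
  + by rewrite ya in nyj.
  + by rewrite ya in njy.
- by rewrite yj orbT.
- have [|ya|ya] := tame_walk4 tD x40 c02 (xx 2) jy.
  + by rewrite eq_sym.
  + by rewrite ya in njy.
  + by rewrite ya in nyj.
- have [|ya|ya] := tame_walk4 tD c02 (xx 2) (xx 3) jy.
  + by rewrite eq_sym.
  + by rewrite -(x5 0) in ya; rewrite ya in njy.
  + by rewrite -(x5 0) in ya; rewrite ya in nyj.
Qed.

(** * Existence of a pentagon *)

Lemma tame_square_kernel (D : digraph) (a b c d : D) :
  tame D -> arc a b -> arc b c -> arc c d -> arc d a -> has_kernel D.
Proof.
move=> tD ab bc cd da; have [asym tri qt conn] := tD.
have := @closed_walk_nth D a [:: b; c; d]; rewrite /= ab bc cd da.
set x := fun i => _ => /(_ isT) cw; have [xx x4] := cw.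
have xC i : x i \in [:: a; b; c; d] by rewrite mem_nth // ltn_pmod.
clearbody x.
pose P y := has_kernel D \/ exists i, y = x i.
have Pall y : P y.
  apply: (connect_ind (P := P) _ (conn (x 0) y)); last by right; exists 0.
  move=> {}y z [|[i ->]] xz; first by left.
  have [zC|zx] := closed_walk_mem z (isT : 0 < 4) cw; first by right.
  left; suff [//|xz'] : has_kernel D \/ forall j, arc (x j) z.
    by case: (tame_no_dominated tD xx xz').
  apply: (closed_walk_ind (P := fun w => arc w z) _ cw _ xz) => // j jz.
  have := tame_walk4 tD (xx j.+1) (xx j.+2) (xx j.+3).
  rewrite -[j.+4]/(4 + j) addnC x4 => /(_ z jz).
  rewrite eq_sym => /(_ (zx _)) [?|zj]; [by right|left].
  (* Inserting [z] between x_j and x_{j+1} gives a pentagon in which the old arc x_j -> x_{j+1} is a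
     chord. *)
  have := @closed_walk_nth D (x j) [:: z; x j.+1; x j.+2; x j.+3].
  have xj : arc (x j.+3) (x j) by rewrite -[x j]x4 addnC.
  rewrite /= jz zj !xx xj => /(_ isT) cw5.
  by apply: (tame_chord_kernel (i := 0) tD cw5); rewrite /= xx.
have [/forallP onC|/forallPn[y yC]] := boolP [forall y, y \in [:: a; b; c; d]].
  exists [set a; c]; split.
    have ac : ~~ arc a c by exact: tri cd da.
    have ca : ~~ arc c a by exact: tri ab bc.
    by move=> u v /set2P[]-> /set2P[]->; rewrite ?arc_irr.
  move=> y; have := onC y; rewrite !inE negb_or => + /andP[/negPf ya /negPf yc].
  rewrite ya yc /=.
  by case/orP=> /eqP->; [exists c|exists a]; rewrite !inE eqxx ?orbT.
have [//|[i yx]] := Pall y.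
by case/negP: yC; rewrite yx.
Qed.

Lemma tame_pentagon (D : digraph) (v : D) :
  tame D -> ~ has_kernel D -> exists x : nat -> D, closed_walk 5 x.
Proof.
move=> tD nk; have [asym tri qt conn] := tD.
have [/existsP[a /existsP[b /existsP[c /existsP[d /existsP[e]]]]]|no5] :=
  boolP [exists a, exists b, exists c, exists d, exists e : D,
    cycle (@arc D) [:: a; b; c; d; e]].
  move=> /closed_walk_nth cw.
  by exists (fun i => nth a [:: a; b; c; d; e] (i %% 5)).
have {}no5 (a b c d e : D) :
    arc a b -> arc b c -> arc c d -> arc d e -> ~~ arc e a.
  move=> ab bc cd de; apply: contra no5 => ea.
  apply/existsP; exists a; apply/existsP; exists b; apply/existsP; exists c.
  apply/existsP; exists d; apply/existsP; exists e.
  by rewrite /= ab bc cd de ea.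
have no4 (a b c d : D) : arc a b -> arc b c -> arc c d -> ~~ arc d a.
  move=> ab bc cd; apply/negP=> da; apply: nk.
  exact: tame_square_kernel tD ab bc cd da.
case: nk; have [/existsP[w vw]|/existsPn vnone] := boolP [exists w, arc v w].
  (* The ball of radius 3 around [w] is out-closed: a 4-walk from [w] to another [z] forces w -> z,
     since z -> w would close a pentagon. Hence it contains [v], and v -> w closes a walk of length
     at most 4. *)
  pose P z := [\/ z = w, arc w z, exists2 s, arc w s & arc s z |
                 exists s t, [/\ arc w s, arc s t & arc t z]].
  suff: P v.
    case=> [vE|wv|[s ws sv]|[s [t [ws st tv]]]].
    - by rewrite vE arc_irr in vw.
    - by have := asym _ _ vw; rewrite wv.
    - by have := tri _ _ _ vw ws; rewrite sv.
    - by have := no4 _ _ _ _ vw ws st; rewrite tv.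
  apply: (connect_ind (P := P) _ (conn w v)); last by constructor 1.
  move=> y z Py yz; case: Py => [yE|wy|[s ws sy]|[s [t [ws st ty]]]].
  - by constructor 2; rewrite -yE.
  - by constructor 3; exists y.
  - by constructor 4; exists s, y.
  - have [->|wz] := eqVneq z w; first by constructor 1.
    have [||zw] := tame_walk4 tD ws st ty yz; first by rewrite eq_sym.
      by constructor 2.
    by have := no5 _ _ _ _ _ ws st ty yz; rewrite zw.
(* Without out-neighbours, [v] is the only vertex by strong connectivity. *)
exists [set v]; split; first by move=> y z /set1P-> /set1P->; rewrite arc_irr.
move=> y; rewrite inE => yv; case/negP: yv.
suff: v = y by move->.
apply: (connect_ind (P := eq v) _ (conn v y)) => // _ z <- vz.
by case/negP: (vnone z).
Qed.

(** * The two digraphs and the characterization *)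

Lemma antihole3_class :
  asymmetrical (antihole 3) /\ quasi_transitive 4 (antihole 3).
Proof.
split.
  move=> u v; rewrite /= !antihole3_arc.
  by case: u => [[|[|[]]] //] ?; case: v => [[|[|[]]] //] ?.
(* A 4-path would need five distinct vertices among three. *)
move=> u v [p [_ up sp _]]; have := card_uniqP up; rewrite /= sp => c5.
by have := max_card (mem (u :: p)); rewrite c5 card_ord.
Qed.

Lemma dicycle5_class :
  asymmetrical (dicycle 5) /\ quasi_transitive 4 (dicycle 5).
Proof.
split.
  move=> u v; rewrite /= /dicycle_arc => /eqP->.
  by rewrite -addrA -subr_eq0 opprD addNKr.
(* Four steps from [u] end at [u] + 4, whose successor is [u]. *)
move=> u v [p [up _ sp <-]]; right.
case: p up sp => [|a [|b [|c [|d [|e p]]]]] //=.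
case/and5P=> /eqP-> /eqP-> /eqP-> /eqP-> _ _.
by rewrite /dicycle_arc -!addrA eq_sym -subr_eq0 addrAC subrr add0r.
Qed.

(* The first two conjuncts: the two digraphs belong to the class.  The third:
   the characterization inside the class. *)
Theorem theorem22 :
  (asymmetrical (antihole 3) /\ quasi_transitive 4 (antihole 3)) /\
  (asymmetrical (dicycle 5) /\ quasi_transitive 4 (dicycle 5)) /\
  (forall D : digraph, asymmetrical D -> quasi_transitive 4 D ->
     (critical_kernel_imperfect D <->
      isomorphic D (antihole 3) \/ isomorphic D (dicycle 5))).
Proof.
split; first exact: antihole3_class.
split; first exact: dicycle5_class.
move=> D asym qt; split=> [cki|]; last first.
  by case=> [/isomorphic_antihole3|] [f [bf farc]]; exact: dicycle_cki bf farc.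
have [/existsP[a /existsP[b /existsP[c tri]]]|notri] :=
  boolP [exists a, exists b, exists c : D, cycle (@arc D) [:: a; b; c]].
  left; apply/isomorphic_antihole3; have cw := closed_walk_nth tri.
  apply: (cki_closed_walk _ _ cki cw) => // i [|[|[|//]]] _.
  - by rewrite addn0 arc_irr.
  - by rewrite addn1; apply: cw.1.
  (* x_{i+2} -> x_{i+3} = x_i is an arc, so its reverse is not. *)
  - apply: negPf; apply: asym; rewrite -[X in arc _ X]cw.2 addn2 addn3.
    exact: cw.1.
right; have tD : tame D.
  split=> // [x y z xy yz|u v]; last exact: cki_connect.
  apply: contra notri => zx; apply/existsP; exists x; apply/existsP; exists y.
  by apply/existsP; exists z; rewrite /= xy yz zx.
have [asymD tri _ _] := tD; have [nk _] := cki.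
have [v _|D0] := pickP (mem [set: D]); last first.
  case: nk; exists set0; split=> [u|u]; first by rewrite inE.
  by have := D0 u; rewrite !inE.
have [x cw] := tame_pentagon v tD nk; have [xx x5] := cw.
apply: (cki_closed_walk _ _ cki cw) => // i m m5.
have x4 : arc (x (i + 4)) (x i) by rewrite -[x i]x5 !addnS addn0.
case: m m5 => [|[|[|[|[|//]]]]] _; rewrite ?addn0 ?arc_irr //.
- by rewrite addn1 xx.
- apply/negP; rewrite addn2 => chord; apply: nk.
  exact: tame_chord_kernel tD cw chord.
(* An arc x_i -> x_{i+3} would close a triangle through x_{i+4}. *)
- apply: negPf; apply: tri _ x4; rewrite !addnS; exact: xx.
- by apply: negPf; apply: asym.
Qed.
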